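(* Let $n \ge 3$ be odd, let $k \ge 0$ be an integer, and let $X$ be the set of $k$-element multisubsets of $[n]=\{1,\dots,n\}$, with the action of the dihedral group $I_2(n)$ induced by its natural action on $[n]$. Then the triple $$\left(X,\ \genfrac{\{}{\}}{0pt}{}{n+k-1}{k}_{s,t},\ I_2(n)\right)$$ exhibits dihedral sieving.
   Context: $I_2(n)=\langle r,s \mid r^n=s^2=e,\ rs=sr^{-1}\rangle$ is the dihedral group of order $2n$. Its natural action on $[n]$ is the one on the vertices of a regular $n$-gon labelled cyclically by $1,\dots,n$ ($r$ acts as $i\mapsto i+1$ and $s$ as $i\mapsto -i$ modulo $n$). $\operatorname{Rep}(I_2(n))$ is the representation ring: the ring generated by isomorphism classes $[U]$ of finite-dimensional complex representations, with $[U\oplus V]=[U]+[V]$ and $[U\otimes V]=[U][V]$. For $n$ odd it is generated as a ring by $z_1$ and $\det$ (hence by $z_1$ and $-\det$). Here $z_1$ is the 2-dimensional representation sending $r$ to the rotation by $2\pi/n$ and $s$ to a reflection matrix, and $\det$ is the 1-dimensional representation with $\det(r)=1$, $\det(s)=-1$. Dihedral sieving: for $n$ odd, a finite $I_2(n)$-set $X$ and a polynomial $P(s,t)\in\mathbb{Z}[s,t]$, the triple $(X,P(s,t),I_2(n))$ exhibits dihedral sieving if $\mathbb{C}[X]=P(z_1,-\det)$ in $\operatorname{Rep}(I_2(n))$, where $\mathbb{C}[X]$ is the permutation representation. (The polynomial variable $s$ is unrelated to the group element $s$.) Generalized Fibonacci polynomials: $\{0\}_{s,t}=0$, $\{1\}_{s,t}=1$,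 $\{m+2\}_{s,t}=s\{m+1\}_{s,t}+t\{m\}_{s,t}$. Put $\{m\}!_{s,t}=\{m\}_{s,t}\{m-1\}_{s,t}\cdots\{1\}_{s,t}$ (with $\{0\}!_{s,t}=1$). The Fibonomial coefficient is $\genfrac{\{}{\}}{0pt}{}{m}{k}_{s,t}=\dfrac{\{m\}!_{s,t}}{\{k\}!_{s,t}\{m-k\}!_{s,t}}$, which is known to be a polynomial in $s,t$ with nonnegative integer coefficients. *)

(* Defs.v *)
From HB Require Import structures.
From mathcomp Require Import all_boot all_order all_algebra all_fingroup.
From mathcomp Require Import all_solvable all_character.
From mathcomp Require Import polyXY generic_quotient complex ring.
From mathcomp Require Import boolp reals trigo.

Set Implicit Arguments.
Unset Strict Implicit.
Unset Printing Implicit Defensive.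

Import GRing.Theory Num.Theory.

Local Open Scope ring_scope.
Local Open Scope quotient_scope.
Local Open Scope complex_scope.

(* The representation ring of G over F, as the commutative ring presented by  *)
(* generators [U], for U a finite-dimensional representation of G, and by     *)
(* relations: [U] = [V] when U and V are isomorphic, [U (+) V] = [U] + [V],   *)
(* [U (x) V] = [U] [V], and [1] = 1 for the trivial representation.           *)
Section RepresentationRing.

Variables (F : fieldType) (gT : finGroupType) (G : {group gT}).

Definition tens_grepr (U V : representation F G) : representation F G :=
  Representation (prod_repr U V).

Fact triv_mx_repr : mx_repr G (fun _ : gT => 1%:M : 'M[F]_1).
Proof. by split=> // g h _ _; rewrite mulmx1. Qed.

Definition triv_grepr : representation F G :=
  Representation (MxRepresentation triv_mx_repr).

Inductive rep_expr : Type :=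
  | RepGen of representation F G
  | RepZero
  | RepOne
  | RepOpp of rep_expr
  | RepAdd of rep_expr & rep_expr
  | RepMul of rep_expr & rep_expr.

Inductive rep_eq : rep_expr -> rep_expr -> Prop :=
  | rep_eq_refl x : rep_eq x x
  | rep_eq_sym x y : rep_eq x y -> rep_eq y x
  | rep_eq_trans y x z : rep_eq x y -> rep_eq y z -> rep_eq x z
  | rep_eq_opp x x' : rep_eq x x' -> rep_eq (RepOpp x) (RepOpp x')
  | rep_eq_add x x' y y' : rep_eq x x' -> rep_eq y y' ->
      rep_eq (RepAdd x y) (RepAdd x' y')
  | rep_eq_mul x x' y y' : rep_eq x x' -> rep_eq y y' ->
      rep_eq (RepMul x y) (RepMul x' y')
  | rep_eq_addA x y z : rep_eq (RepAdd x (RepAdd y z)) (RepAdd (RepAdd x y) z)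
  | rep_eq_addC x y : rep_eq (RepAdd x y) (RepAdd y x)
  | rep_eq_add0 x : rep_eq (RepAdd RepZero x) x
  | rep_eq_addN x : rep_eq (RepAdd (RepOpp x) x) RepZero
  | rep_eq_mulA x y z : rep_eq (RepMul x (RepMul y z)) (RepMul (RepMul x y) z)
  | rep_eq_mulC x y : rep_eq (RepMul x y) (RepMul y x)
  | rep_eq_mul1 x : rep_eq (RepMul RepOne x) x
  | rep_eq_mulD x y z :
      rep_eq (RepMul (RepAdd x y) z) (RepAdd (RepMul x z) (RepMul y z))
  | rep_eq_iso (U V : representation F G) :
      mx_rsim U V -> rep_eq (RepGen U) (RepGen V)
  | rep_eq_dsum U V :
      rep_eq (RepGen (dadd_grepr U V)) (RepAdd (RepGen U) (RepGen V))
  | rep_eq_tens U V :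
      rep_eq (RepGen (tens_grepr U V)) (RepMul (RepGen U) (RepGen V))
  | rep_eq_triv : rep_eq (RepGen triv_grepr) RepOne.

HB.instance Definition _ := gen_eqMixin rep_expr.
HB.instance Definition _ := gen_choiceMixin rep_expr.

Definition rep_eqb : rel rep_expr := fun x y => `[< rep_eq x y >].

Fact rep_eqb_refl : reflexive rep_eqb.
Proof. by move=> x; apply/asboolP/rep_eq_refl. Qed.

Fact rep_eqb_sym : symmetric rep_eqb.
Proof. by move=> x y; apply/asboolP/asboolP => /rep_eq_sym. Qed.

Fact rep_eqb_trans : transitive rep_eqb.
Proof.
move=> y x z /asboolP xy /asboolP yz; apply/asboolP.
exact: rep_eq_trans xy yz.
Qed.

Canonical rep_equiv := EquivRel rep_eqb rep_eqb_refl rep_eqb_sym rep_eqb_trans.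

Definition rep_ring : Type := {eq_quot rep_equiv}.

HB.instance Definition _ := Choice.on rep_ring.

Definition rep_pi (x : rep_expr) : rep_ring := \pi_({eq_quot rep_equiv}) x.

Lemma rep_piP x y : rep_pi x = rep_pi y <-> rep_eq x y.
Proof.
split=> [/eqP|xy]; first by rewrite /rep_pi eqmodE => /asboolP.
by apply/eqP; rewrite /rep_pi eqmodE; apply/asboolP.
Qed.

Definition rep_repr (u : rep_ring) : rep_expr := repr (u : {eq_quot rep_equiv}).

Lemma rep_reprK : cancel rep_repr rep_pi.
Proof. by move=> u; apply: reprK. Qed.

Lemma rep_repr_pi x : rep_eq (rep_repr (rep_pi x)) x.
Proof. by apply/rep_piP; rewrite rep_reprK. Qed.

Definition rep_zero := rep_pi RepZero.
Definition rep_one := rep_pi RepOne.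
Definition rep_opp u := rep_pi (RepOpp (rep_repr u)).
Definition rep_add u v := rep_pi (RepAdd (rep_repr u) (rep_repr v)).
Definition rep_mul u v := rep_pi (RepMul (rep_repr u) (rep_repr v)).

Lemma rep_oppE x : rep_opp (rep_pi x) = rep_pi (RepOpp x).
Proof. by apply/rep_piP/rep_eq_opp/rep_repr_pi. Qed.

Lemma rep_addE x y : rep_add (rep_pi x) (rep_pi y) = rep_pi (RepAdd x y).
Proof. by apply/rep_piP/rep_eq_add; apply: rep_repr_pi. Qed.

Lemma rep_mulE x y : rep_mul (rep_pi x) (rep_pi y) = rep_pi (RepMul x y).
Proof. by apply/rep_piP/rep_eq_mul; apply: rep_repr_pi. Qed.

Fact rep_addA : associative rep_add.
Proof.
move=> u v w; rewrite -(rep_reprK u) -(rep_reprK v) -(rep_reprK w) !rep_addE.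
exact/rep_piP/rep_eq_addA.
Qed.

Fact rep_addC : commutative rep_add.
Proof.
move=> u v; rewrite -(rep_reprK u) -(rep_reprK v) !rep_addE.
exact/rep_piP/rep_eq_addC.
Qed.

Fact rep_add0 : left_id rep_zero rep_add.
Proof.
by move=> u; rewrite -(rep_reprK u) rep_addE; apply/rep_piP/rep_eq_add0.
Qed.

Fact rep_addN : left_inverse rep_zero rep_opp rep_add.
Proof.
move=> u; rewrite -(rep_reprK u) rep_oppE rep_addE.
exact/rep_piP/rep_eq_addN.
Qed.

HB.instance Definition _ :=
  GRing.isZmodule.Build rep_ring rep_addA rep_addC rep_add0 rep_addN.

Fact rep_mulA : associative rep_mul.
Proof.
move=> u v w; rewrite -(rep_reprK u) -(rep_reprK v) -(rep_reprK w) !rep_mulE.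
exact/rep_piP/rep_eq_mulA.
Qed.

Fact rep_mulC : commutative rep_mul.
Proof.
move=> u v; rewrite -(rep_reprK u) -(rep_reprK v) !rep_mulE.
exact/rep_piP/rep_eq_mulC.
Qed.

Fact rep_mul1 : left_id rep_one rep_mul.
Proof.
by move=> u; rewrite -(rep_reprK u) rep_mulE; apply/rep_piP/rep_eq_mul1.
Qed.

Fact rep_mulD : left_distributive rep_mul rep_add.
Proof.
move=> u v w; rewrite -(rep_reprK u) -(rep_reprK v) -(rep_reprK w).
by rewrite !(rep_addE, rep_mulE); apply/rep_piP/rep_eq_mulD.
Qed.

(* Characters are well defined on rep_ring, so it is not trivial. *)
Fixpoint rep_expr_char (g : gT) (x : rep_expr) : F :=
  match x with
  | RepGen U => \tr (U g)
  | RepZero => 0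
  | RepOne => 1
  | RepOpp y => - rep_expr_char g y
  | RepAdd y z => rep_expr_char g y + rep_expr_char g z
  | RepMul y z => rep_expr_char g y * rep_expr_char g z
  end.

Lemma rep_eq_char g x y :
  g \in G -> rep_eq x y -> rep_expr_char g x = rep_expr_char g y.
Proof.
move=> Gg; elim=> //=.
- by move=> {}y {}x z _ -> _ ->.
- by move=> {}x x' _ ->.
- by move=> {}x x' {}y y' _ -> _ ->.
- by move=> {}x x' {}y y' _ -> _ ->.
- by move=> *; rewrite addrA.
- by move=> *; rewrite addrC.
- by move=> *; rewrite add0r.
- by move=> *; rewrite addNr.
- by move=> *; rewrite mulrA.
- by move=> *; rewrite mulrC.
- by move=> *; rewrite mul1r.
- by move=> *; rewrite mulrDl.
- move=> U V /mx_rsim_def[f12 [f21 fK ->]] //.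
  by rewrite mxtrace_mulC mulmxA fK mul1mx.
- by move=> U V; rewrite mxtrace_block.
- by move=> U V; rewrite mxtrace_prod.
- by rewrite mxtrace1.
Qed.

Fact rep_one_neq0 : rep_one != rep_zero.
Proof.
apply/eqP => /rep_piP /(rep_eq_char (group1 G)) /= /eqP.
by rewrite oner_eq0.
Qed.

HB.instance Definition _ :=
  GRing.Zmodule_isComNzRing.Build rep_ring
    rep_mulA rep_mulC rep_mul1 rep_mulD rep_one_neq0.

Definition rep_class (U : representation F G) : rep_ring := rep_pi (RepGen U).

Lemma rep_class_iso (U V : representation F G) :
  mx_rsim U V -> rep_class U = rep_class V.
Proof. by move=> UV; apply/rep_piP/rep_eq_iso. Qed.

Lemma rep_class_dsum U V :
  rep_class (dadd_grepr U V) = rep_class U + rep_class V.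
Proof. by rewrite [RHS]rep_addE; apply/rep_piP/rep_eq_dsum. Qed.

Lemma rep_class_tens U V :
  rep_class (tens_grepr U V) = rep_class U * rep_class V.
Proof. by rewrite [RHS]rep_mulE; apply/rep_piP/rep_eq_tens. Qed.

Lemma rep_class_triv : rep_class triv_grepr = 1.
Proof. exact/rep_piP/rep_eq_triv. Qed.

End RepresentationRing.

(* The permutation representation C[X] of a finite G-set X, on the basis X.   *)
(* Actions are right actions and representations act on row vectors, so that  *)
(* the basis vector e_x is sent by g to e_(x.g).                              *)
Section PermutationRepresentation.

Variables (F : fieldType) (gT : finGroupType).
Variables (X : finType) (to : {action gT &-> X}).

Definition permutation_mx (g : gT) : 'M[F]_#|X| :=
  \matrix_(i, j) (enum_val j == to (enum_val i) g)%:R.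

Fact permutation_mx_repr : mx_repr [set: gT] permutation_mx.
Proof.
split=> [|g h _ _].
  apply/matrixP=> i j; rewrite !mxE act1 (inj_eq enum_val_inj).
  by rewrite eq_sym.
apply/matrixP=> i j; rewrite !mxE (bigD1 (enum_rank (to (enum_val i) g))) //=.
rewrite !mxE enum_rankK eqxx mul1r -actM big1 ?addr0 // => k.
rewrite -(inj_eq enum_val_inj) enum_rankK => /negbTE nk.
by rewrite !mxE nk mul0r.
Qed.

Definition permutation_grepr : representation F [set: gT] :=
  Representation (MxRepresentation permutation_mx_repr).

End PermutationRepresentation.

(* k-element multisubsets of T, given by their multiplicity functions (a      *)
(* multiplicity is at most k, whence the codomain 'I_k.+1).                   *)
Definition multisubset (T : finType) (k : nat) : Type :=
  {f : {ffun T -> 'I_k.+1} | (\sum_(x : T) (f x : nat) == k)%N}.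

HB.instance Definition _ (T : finType) (k : nat) :=
  SubFinite.on (multisubset T k).

Section MultisubsetAction.

Variables (gT : finGroupType) (T : finType) (to : {action gT &-> T}).
Variable k : nat.

(* The multiplicity of x.g in m.g is the multiplicity of x in m. *)
Definition multisubset_act_fun (m : multisubset T k) (g : gT) :
  {ffun T -> 'I_k.+1} := [ffun x => val m (to x g^-1%g)].

Fact multisubset_act_subproof (m : multisubset T k) (g : gT) :
  (\sum_(x : T) (multisubset_act_fun m g x : nat) == k)%N.
Proof.
apply/eqP; transitivity (\sum_(x : T) (val m x : nat))%N;
  last by apply/eqP; case: m.
rewrite [RHS](reindex_inj (act_inj to g^-1%g)).
by apply: eq_bigr => x _; rewrite ffunE.
Qed.

Definition multisubset_act (m : multisubset T k) (g : gT) : multisubset T k :=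
  exist _ (multisubset_act_fun m g) (multisubset_act_subproof m g).

Fact multisubset_act1 : multisubset_act^~ 1%g =1 id.
Proof.
by move=> m; apply/val_inj/ffunP => x; rewrite ffunE invg1 act1.
Qed.

Fact multisubset_actM m : act_morph multisubset_act m.
Proof.
move=> g h; apply/val_inj/ffunP => x.
by rewrite !ffunE invMg actM.
Qed.

Definition multisubset_action : {action gT &-> multisubset T k} :=
  TotalAction multisubset_act1 multisubset_actM.

End MultisubsetAction.

(* The dihedral group I_2(n): the pair (i, b) stands for r^i s^b, where i is  *)
(* taken modulo n and s r^j = r^-j s. As 'Z_n is Z/n only for n > 1, this is  *)
(* the dihedral group of order 2 n for n > 1.                                 *)
Definition dihedral (n : nat) : Type := ('Z_n * bool)%type.

HB.instance Definition _ (n : nat) := Finite.on (dihedral n).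

Section DihedralGroup.

Variable n : nat.
Implicit Types g h : dihedral n.

Definition dihedral_one : dihedral n := (0, false).

Definition dihedral_mul g h : dihedral n :=
  (g.1 + (if g.2 then - h.1 else h.1), g.2 (+) h.2).

Definition dihedral_inv g : dihedral n := (if g.2 then g.1 else - g.1, g.2).

Fact dihedral_mulA : associative dihedral_mul.
Proof.
move=> [i b] [j c] [l d]; rewrite /dihedral_mul /= addbA -addrA.
by case: b; case: c; rewrite //= ?opprD ?opprK.
Qed.

Fact dihedral_mul1 : left_id dihedral_one dihedral_mul.
Proof. by move=> [i b]; rewrite /dihedral_mul /= add0r. Qed.

Fact dihedral_mulV : left_inverse dihedral_one dihedral_inv dihedral_mul.
Proof.
by move=> [i []]; rewrite /dihedral_mul /dihedral_one /= ?subrr ?addNr.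
Qed.

HB.instance Definition _ :=
  Finite_isGroup.Build (dihedral n) dihedral_mulA dihedral_mul1 dihedral_mulV.

Lemma dihedral_mulE g h :
  (g * h)%g = (g.1 + (if g.2 then - h.1 else h.1), g.2 (+) h.2) :> dihedral n.
Proof. by []. Qed.

Definition dihedral_r : dihedral n := (1, false).
Definition dihedral_s : dihedral n := (0, true).

Lemma dihedral_rX m : (dihedral_r ^+ m)%g = (m%:R, false).
Proof.
elim: m => [|m IHm]; first by rewrite expg0.
by rewrite expgS IHm dihedral_mulE /= -natr1 addrC.
Qed.

Lemma dihedralE g : g = (dihedral_r ^+ g.1 * dihedral_s ^+ g.2)%g.
Proof.
case: g => i b; rewrite dihedral_rX natr_Zp.
by case: b; rewrite ?expg1 ?expg0 dihedral_mulE /= ?addr0.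
Qed.

Lemma dihedral_gen : <<[set dihedral_r; dihedral_s]>>%g = [set: dihedral n].
Proof.
apply/eqP; rewrite eqEsubset subsetT; apply/subsetP => g _.
by rewrite (dihedralE g) groupM // groupX // mem_gen // !inE eqxx ?orbT.
Qed.

Lemma dihedral_s2 : (dihedral_s ^+ 2 = 1)%g.
Proof. by rewrite expgS expg1 dihedral_mulE /= oppr0 addr0. Qed.

Lemma dihedral_rs : (dihedral_r * dihedral_s = dihedral_s * dihedral_r^-1)%g.
Proof. by rewrite !dihedral_mulE /= addr0 opprK add0r. Qed.

Hypothesis n_gt1 : (1 < n)%N.

Lemma dihedral_rn : (dihedral_r ^+ n = 1)%g.
Proof. by rewrite dihedral_rX pchar_Zp. Qed.

Lemma dihedral_card : #|[set: dihedral n]| = n.*2.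
Proof. by rewrite cardsT card_prod card_bool card_ord Zp_cast // muln2. Qed.

(* The presentation <r, s | r^n = s^2 = 1, r s = s r^-1>. *)
Lemma dihedral_Grp :
  ([set: dihedral n] \isog Grp (x : y : x ^+ n, y ^+ 2, x * y = y * x^-1))%g.
Proof.
have relE (hT : finGroupType) (x y : hT) :
    ((x * y)%g == (y * x^-1)%g) = ((x ^ y)%g == (x^-1)%g).
  by rewrite conjgE -[RHS](inj_eq (mulgI y)) mulKVg.
have GrpE (hT : finGroupType) (H : {group hT}) :
    (H \homg Grp (x : y : x ^+ n, y ^+ 2, x * y = y * x^-1))%g =
    (H \homg Grp (x : y : x ^+ n, y ^+ 2, x ^ y = x^-1))%g.
  by apply: eq_existsb => -[x y] /=; rewrite !xpair_eqE relE.
have D_Grp := Grp_dihedral n_gt1.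
move=> hT H; rewrite GrpE; apply: (isoGrp_trans _ D_Grp).
apply/(isoGrpP _ D_Grp); rewrite card_dihedral // dihedral_card; split=> //.
rewrite -GrpE; apply/existsP; exists (dihedral_r, dihedral_s).
rewrite /= dihedral_rn dihedral_s2 dihedral_rs joing_idl joing_idr.
by rewrite [(_ <*> _)%g]dihedral_gen.
Qed.

End DihedralGroup.

(* The natural action on the vertices of the n-gon, labelled by 'Z_n: r acts  *)
(* as i |-> i + 1 and s as i |-> - i. The label n of [n] is 0 here.           *)
Section NaturalAction.

Variable n : nat.

Definition dihedral_act_fun (x : 'Z_n) (g : dihedral n) : 'Z_n :=
  if g.2 then - (x + g.1) else x + g.1.

Fact dihedral_act1 : dihedral_act_fun^~ 1%g =1 id.
Proof. by move=> x; rewrite /dihedral_act_fun /= addr0. Qed.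

Fact dihedral_actM x : act_morph dihedral_act_fun x.
Proof.
move=> [i b] [j c]; rewrite dihedral_mulE /dihedral_act_fun /=.
by case: b; case: c; rewrite /= ?opprD ?opprK ?addrA.
Qed.

Definition dihedral_action : {action dihedral n &-> 'Z_n} :=
  TotalAction dihedral_act1 dihedral_actM.

Lemma dihedral_action_r x : dihedral_action x (dihedral_r n) = x + 1.
Proof. by []. Qed.

Lemma dihedral_action_s x : dihedral_action x (dihedral_s n) = - x.
Proof. by rewrite /= /dihedral_act_fun /= addr0. Qed.

End NaturalAction.

Section DihedralRepresentations.

Variables (R : realType) (n : nat).

Definition rotation_mx (a : R) : 'M[R[i]]_2 :=
  \matrix_(i, j) (if i == j then cos a else if (i < j)%N then - sin a
                                                         else sin a)%:C.

Definition reflection_mx : 'M[R[i]]_2 := diag_mx (\row_j (-1) ^+ j).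

Lemma rotation_mx0 : rotation_mx 0 = 1%:M.
Proof.
apply/matrixP=> i j; rewrite !mxE cos0 sin0 oppr0 if_same.
by case: (i == j).
Qed.

Lemma rotation_mxD a b : rotation_mx (a + b) = rotation_mx a *m rotation_mx b.
Proof.
apply/matrixP=> i j; rewrite !mxE !big_ord_recl big_ord0 !mxE addr0 cosD sinD.
case: i => -[|[|//]] ?; case: j => -[|[|//]] ? /=;
  rewrite -!rmorphM -rmorphD /=; congr (_ %:C); ring.
Qed.

Lemma reflection_rotation_mx a :
  reflection_mx *m rotation_mx a = rotation_mx (- a) *m reflection_mx.
Proof.
rewrite mul_diag_mx mul_mx_diag; apply/matrixP=> i j; rewrite !mxE cosN sinN.
case: i => -[|[|//]] ?; case: j => -[|[|//]] ? /=;
  by rewrite ?expr0 ?expr1 ?(mul1r, mulr1, mulrN1, mulN1r, opprK, rmorphN).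
Qed.

Lemma reflection_mx2 : reflection_mx *m reflection_mx = 1%:M.
Proof.
rewrite mul_diag_mx; apply/matrixP=> i j; rewrite !mxE mulrnAr -exprD.
by rewrite addnn -mul2n exprM sqrrN !expr1n.
Qed.

(* Rotation by 2 pi i / n; the modulus (Zp_trunc n).+2 of 'Z_n is n if n > 1. *)
Definition dihedral_rotation (i : 'Z_n) : 'M[R[i]]_2 :=
  rotation_mx (2 * pi / (Zp_trunc n).+2%:R * i%:R).

Definition z1_mx (g : dihedral n) : 'M[R[i]]_2 :=
  dihedral_rotation g.1 *m (if g.2 then reflection_mx else 1%:M).

Lemma rotation_mx_period a m : rotation_mx (a + 2 * pi *+ m) = rotation_mx a.
Proof.
apply/matrixP=> i j; rewrite !mxE mulr_natl.
by rewrite (periodicn (@cosD2pi R)) (periodicn (@sinD2pi R)).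
Qed.

Fact dihedral_rotationD i j :
  dihedral_rotation (i + j) = dihedral_rotation i *m dihedral_rotation j.
Proof.
rewrite /dihedral_rotation -rotation_mxD -mulrDr -natrD.
set N := (Zp_trunc n).+2; set q := ((i + j) %/ N)%N.
have -> : (i + j)%N%:R = q%:R * N%:R + ((i + j) %% N)%N%:R :> R.
  by rewrite -natrM -natrD -divn_eq.
have distr (p l : R) :
    p / N%:R * (q%:R * N%:R + l) = p / N%:R * l + p *+ q.
  by rewrite -[p *+ q]mulr_natl; field; rewrite pnatr_eq0.
by rewrite distr rotation_mx_period.
Qed.

Fact z1_mx_repr : mx_repr [set: dihedral n] z1_mx.
Proof.
have rot0 : dihedral_rotation 0 = 1%:M.
  by rewrite /dihedral_rotation mulr0 rotation_mx0.
have rotN j : dihedral_rotation (- j) =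
    rotation_mx (- (2 * pi / (Zp_trunc n).+2%:R * j%:R)).
  rewrite -[RHS]mul1mx -rot0 -(addNr j) dihedral_rotationD -mulmxA.
  by rewrite -rotation_mxD subrr rotation_mx0 mulmx1.
split=> [|[i b] [j c] _ _]; first by rewrite /z1_mx rot0 mulmx1.
rewrite /z1_mx dihedral_mulE /= dihedral_rotationD.
case: b; rewrite ?mulmx1 -?mulmxA //=; congr (_ *m _).
rewrite [in RHS]mulmxA reflection_rotation_mx -rotN -mulmxA; congr (_ *m _).
by case: c; rewrite ?reflection_mx2 ?mulmx1.
Qed.

Definition z1 : representation R[i] [set: dihedral n] :=
  Representation (MxRepresentation z1_mx_repr).

Lemma z1_r : (1 < n)%N -> z1 (dihedral_r n) = rotation_mx (2 * pi / n%:R).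
Proof.
by move=> n_gt1; rewrite /= /z1_mx /dihedral_rotation /= mulmx1 mulr1 Zp_cast.
Qed.

Lemma z1_s : z1 (dihedral_s n) = reflection_mx.
Proof.
by rewrite /= /z1_mx /dihedral_rotation /= mulr0 rotation_mx0 mul1mx.
Qed.

Definition det_mx (g : dihedral n) : 'M[R[i]]_1 := ((-1) ^+ g.2)%:M.

Fact det_mx_repr : mx_repr [set: dihedral n] det_mx.
Proof.
split=> [|g h _ _]; rewrite /det_mx ?expr0 //.
by rewrite dihedral_mulE /= signr_addb scalar_mxM.
Qed.

Definition det_grepr : representation R[i] [set: dihedral n] :=
  Representation (MxRepresentation det_mx_repr).

End DihedralRepresentations.

(* Z[s, t] is {poly {poly int}}, with s = 'X and t = 'Y = 'X%:P. *)
Fixpoint fib_poly (m : nat) : {poly {poly int}} :=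
  match m with
  | 0 => 0
  | 1 => 1
  | (m'.+1 as m1).+1 => 'X * fib_poly m1 + 'Y * fib_poly m'
  end.

Definition fib_fact (m : nat) : {poly {poly int}} :=
  \prod_(1 <= i < m.+1) fib_poly i.

(* Euclidean division in 'X; it is exact for k <= m, see fibonomialK. *)
Definition fibonomial (m k : nat) : {poly {poly int}} :=
  fib_fact m %/ (fib_fact k * fib_fact (m - k)).

Lemma fib_polySS m :
  fib_poly m.+2 = 'X * fib_poly m.+1 + 'Y * fib_poly m.
Proof. by []. Qed.

Lemma fib_fact0 : fib_fact 0 = 1.
Proof. by rewrite /fib_fact big_geq. Qed.

Lemma fib_factS m : fib_fact m.+1 = fib_poly m.+1 * fib_fact m.
Proof. by rewrite /fib_fact big_nat_recr //= mulrC. Qed.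

Lemma size_fib_poly m : size (fib_poly m.+1) = m.+1 /\ fib_poly m.+1 \is monic.
Proof.
elim/ltn_ind: m => -[|m] IHm; first by rewrite size_poly1 monic1.
have [size_m1 mon_m1] := IHm m (leqnn _).
have size_X : size ('X * fib_poly m.+1) = m.+2.
  by rewrite mulrC size_mulX ?size_m1 // monic_neq0.
have lt_size : (size ('Y * fib_poly m)%R < size ('X * fib_poly m.+1)%R)%N.
  rewrite size_X ltnS mul_polyC (leq_trans (size_scale_leq _ _)) //.
  case: m IHm {size_m1 mon_m1 size_X} => [|m] IHm; first by rewrite size_poly0.
  by have [->] := IHm m (leqnSn _).
rewrite fib_polySS size_polyDl // size_X; split=> //.
by rewrite monicE lead_coefDl // -monicE monicMl ?monicX.
Qed.

Lemma fib_fact_monic m : fib_fact m \is monic.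
Proof.
elim: m => [|m IHm]; first by rewrite fib_fact0 monic1.
by rewrite fib_factS monicMl //; case: (size_fib_poly m).
Qed.

Lemma fib_polyD a b :
  fib_poly (a.+1 + b) =
  fib_poly a.+1 * fib_poly b.+1 + 'Y * fib_poly a * fib_poly b.
Proof.
elim/ltn_ind: b => -[|[|b]] IHb.
- by rewrite addn0 /= mulr0 addr0 mulr1.
- by rewrite addn1 !fib_polySS /= mulr0 addr0 !mulr1 [_ * 'X]mulrC.
have e : (a.+1 + b.+2 = (a.+1 + b).+2)%N by rewrite !addnS.
rewrite e fib_polySS -addnS !IHb // (fib_polySS b.+1) (fib_polySS b).
ring.
Qed.

Lemma fib_fact_dvd a b :
  exists q, fib_fact (a + b) = q * (fib_fact a * fib_fact b).
Proof.
elim: a b => [|a IHa] b.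
  by exists 1; rewrite fib_fact0 !mul1r.
elim: b => [|b [q2 IHb]].
  by exists 1; rewrite addn0 fib_fact0 mul1r mulr1.
have [q1 E1] := IHa b.+1; exists (fib_poly b.+2 * q1 + 'Y * fib_poly a * q2).
have E2 : fib_fact (a + b.+1) = q2 * (fib_fact a.+1 * fib_fact b).
  by rewrite addnS -addSn.
rewrite addSn fib_factS.
rewrite (_ : fib_poly (a + b.+1).+1 = fib_poly (a.+1 + b.+1)); last first.
  by rewrite addSn.
rewrite fib_polyD mulrDl {1}E1 E2 !fib_factS.
ring.
Qed.

Lemma fibonomialK m k : (k <= m)%N ->
  fibonomial m k * (fib_fact k * fib_fact (m - k)) = fib_fact m.
Proof.
move=> le_km; rewrite /fibonomial.
have [q] := fib_fact_dvd k (m - k); rewrite subnKC // => ->.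
by rewrite Pdiv.IdomainMonic.mulpK // monicMl // fib_fact_monic.
Qed.

(* P(x, y) for P in Z[s, t] and x, y in a commutative ring A. *)
Definition eval_ZXY (A : comNzRingType) (P : {poly {poly int}}) (x y : A) : A :=
  (map_poly (map_poly intr) P).[x, y].

(* The notion of dihedral sieving is meant for odd n. *)
Definition dihedral_sieving (R : realType) (n : nat) (X : finType)
    (to : {action dihedral n &-> X}) (P : {poly {poly int}}) : Prop :=
  rep_class (permutation_grepr R[i] to) =
  eval_ZXY P (rep_class (z1 R n)) (- rep_class (det_grepr R n)).

(* Main.v *)
Require Import Defs.
From HB Require Import structures.
From mathcomp Require Import all_boot all_order all_algebra all_fingroup.
From mathcomp Require Import all_solvable all_character.
From mathcomp Require Import polyXY complex ring lra zify.
From mathcomp Require Import reals trigo.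

(** Over a field of characteristic 0, two elements of the representation ring of
    a finite group are equal as soon as their characters are ([rep_char_inj]).
    Taking characters is a ring morphism, so the theorem reduces to an identity
    of complex numbers for each [g] in the dihedral group: the number of
    [k]-multisubsets fixed by [g] is the value of the Fibonomial coefficient at
    [s = tr (z1 g)] and [t = - det g].

    Write [s = x + y] and [t = - x y]. The Fibonacci polynomial [{m}] becomes
    the homogeneous q-integer [(x^m - y^m) / (x - y)], and the Fibonomial
    coefficient becomes the homogeneous q-binomial coefficient
    [qbin x y (n - 1) k] ([eval_fibonomial]). By the q-binomial theorem
    ([qbin_series]), this is the coefficient of [X^k] in the inverse of the
    product of the [1 - x^j y^(n-1-j) X] for [0 <= j < n].

    On the other side, a multisubset is fixed by [g] when its multiplicity is
    constant on each orbit of [g], so the number of fixed [k]-multisubsets is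
    the coefficient of [X^k] in the inverse of the product of the [1 - X^|O|],
    with [O] ranging over the orbits of [g] on the vertices
    ([card_fixed_multisubsets_qbin]).

    It remains to see that the two products are equal. A rotation of order [d]
    acts by a primitive [d]-th root of unity [z], with [x = z] and [y = 1/z].
    It has [n/d] orbits, all of size [d], and since [n] is odd the exponents
    [2j + 1 - n] of [z] run [n/d] times through all residues modulo [d]: both
    products are [(1 - X^d)^(n/d)]. A reflection has [x = 1] and [y = -1]; it
    fixes one vertex and exchanges the others in pairs, and both products are
    [(1 - X) (1 - X^2)^((n-1)/2)]. *)

Set Implicit Arguments.
Unset Strict Implicit.
Unset Printing Implicit Defensive.

Import Order.TTheory GRing.Theory Num.Theory.

Local Open Scope ring_scope.
Local Open Scope complex_scope.

(** * Characters determine elements of the representation ring *)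

Section RepChar.
Variables (F : fieldType) (gT : finGroupType) (G : {group gT}) (g : gT).
Hypothesis Gg : g \in G.

(** The trace at [g] respects the relations of the representation ring only for
    [g] in [G]; taking the membership proof as an argument lets the ring
    morphism structure be attached to the function itself. *)
Definition rep_char & g \in G := fun u : rep_ring F G =>
  rep_expr_char g (rep_repr u).

Lemma rep_char_pi x : rep_char Gg (rep_pi x) = rep_expr_char g x.
Proof. exact/(rep_eq_char Gg)/rep_repr_pi. Qed.

Fact rep_char_zmod_morphism : zmod_morphism (rep_char Gg).
Proof.
move=> u v; rewrite -(rep_reprK u) -(rep_reprK v) [- _]rep_oppE.
by rewrite [_ + _]rep_addE !rep_char_pi.
Qed.

Fact rep_char_monoid_morphism : monoid_morphism (rep_char Gg).
Proof.
split=> [|u v]; first exact: rep_char_pi.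
by rewrite -(rep_reprK u) -(rep_reprK v) [_ * _]rep_mulE !rep_char_pi.
Qed.

HB.instance Definition _ := GRing.isZmodMorphism.Build (rep_ring F G) F
  (rep_char Gg) rep_char_zmod_morphism.
HB.instance Definition _ := GRing.isMonoidMorphism.Build (rep_ring F G) F
  (rep_char Gg) rep_char_monoid_morphism.

Lemma rep_char_class U : rep_char Gg (rep_class U) = \tr (U g).
Proof. exact: rep_char_pi. Qed.

End RepChar.

Section TraceLemmas.
Variable F : fieldType.

Lemma mxtrace_lin_mul m n (B : 'M[F]_m) (C : 'M[F]_n) :
  \tr (lin_mx (mulmxr C \o mulmx B : 'M_(m, n) -> 'M_(m, n))) = \tr B * \tr C.
Proof.
rewrite /mxtrace (reindex _ (curry_mxvec_bij _ _)) /= mulr_suml.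
rewrite (eq_bigr (fun i => \sum_j B i i * C j j)) => [|i _]; last first.
  by rewrite mulr_sumr.
rewrite pair_bigA; apply: eq_bigr => -[i j] _ /=.
set f := (X in lin_mx X); set k := mxvec_index i j.
transitivity ((row k (lin_mx f)) 0 k); first by rewrite [RHS]mxE.
rewrite rowE -mxvec_delta mul_vec_lin mxvecE /f /=.
rewrite -(mul_delta_mx (0 : 'I_1)) mulmxA -(mulmxA _ _ C) -colE -rowE.
by rewrite mxE big_ord1 !mxE.
Qed.

(** A rank factorization [E = C *m B] of an idempotent satisfies [B *m C = 1],
    and [C *m B] has the same trace as [B *m C]. *)
Lemma mxtrace_idempotent n (E : 'M[F]_n) :
  E *m E = E -> \tr E = (\rank E)%:R.
Proof.
move=> EE; rewrite -{1}[E]mulmx_base mxtrace_mulC -mxtrace1; congr (\tr _).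
apply: (row_free_inj (row_base_free E)).
apply: (row_full_inj (col_base_full E)).
have := mulmx_base E; move: (col_base E) (row_base E) => C B /= defE.
by rewrite mul1mx !mulmxA defE -mulmxA defE.
Qed.
End TraceLemmas.

Section Intertwiners.
Variables (F : fieldType) (gT : finGroupType) (G : {group gT}).
Hypothesis charF0 : [pchar F] =i pred0.

Let natf_eq0 n : (n%:R == 0 :> F) = (n == 0)%N.
Proof. by move/pcharf0P: charF0. Qed.

Let nz_G : #|G|%:R != 0 :> F.
Proof. by rewrite natf_eq0 -lt0n cardG_gt0. Qed.

Section Average.
Variables (m n : nat).
Variables (rW : mx_representation F G m) (rU : mx_representation F G n).

(** The projector of the space of all matrices onto the space of intertwiners
    from [rW] to [rU]. *)
Definition hom_average (A : 'M[F]_(m, n)) :=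
  #|G|%:R^-1 *: \sum_(g in G) rW g^-1%g *m A *m rU g.

Fact hom_average_is_linear : linear hom_average.
Proof.
move=> a A B; rewrite /hom_average /= scalerA mulrC -scalerA -scalerDr.
rewrite [X in _ = _ *: (X + _)]scaler_sumr -big_split.
congr (_ *: _); apply: eq_bigr => g _.
by rewrite mulmxDr mulmxDl -scalemxAr -scalemxAl.
Qed.
HB.instance Definition _ := GRing.isLinear.Build F 'M[F]_(m, n) 'M[F]_(m, n) _
  hom_average hom_average_is_linear.

Lemma hom_averageJ A g :
  g \in G -> rW g *m hom_average A = hom_average A *m rU g.
Proof.
move=> Gg; rewrite -scalemxAr -scalemxAl; congr (_ *: _).
rewrite mulmx_sumr mulmx_suml (reindex_acts 'R _ Gg) ?astabsR //=.
apply: eq_bigr => h Gh; rewrite invMg !repr_mxM ?groupV ?groupM // !mulmxA.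
by rewrite -(repr_mxM rW) ?groupV // mulgV repr_mx1 mul1mx.
Qed.

Lemma hom_average_id A :
  (forall g, g \in G -> rW g *m A = A *m rU g) -> hom_average A = A.
Proof.
move=> homA; rewrite /hom_average (eq_bigr (fun=> A)) => [|g Gg]; last first.
  by rewrite -mulmxA -homA // mulmxA -repr_mxM ?groupV // mulVg repr_mx1 mul1mx.
by rewrite sumr_const -[A *+ _]scaler_nat scalerA mulVf // scale1r.
Qed.

Lemma mxtrace_hom_average :
  \tr (lin_mx hom_average) =
  #|G|%:R^-1 * \sum_(g in G) \tr (rW g^-1%g) * \tr (rU g).
Proof.
have -> : lin_mx hom_average = #|G|%:R^-1 *:
    \sum_(g in G) lin_mx (mulmxr (rU g) \o mulmx (rW g^-1%g)).
  apply/row_matrixP => i; rewrite !rowE.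
  rewrite -[delta_mx 0 i]vec_mxK mul_vec_lin -scalemxAr mulmx_sumr /hom_average.
  rewrite linearZ linear_sum; congr (_ *: _); apply: eq_bigr => g _.
  by rewrite mul_vec_lin.
rewrite linearZ linear_sum; congr (_ * _); apply: eq_bigr => g _.
exact: mxtrace_lin_mul.
Qed.

(** The averaging projector has trace [1/|G|] times the sum below, and its trace
    is its rank. So in characteristic 0 the existence of a nonzero intertwiner
    can be read off the characters. *)
Lemma hom_trace_neq0 :
  (exists2 A, A != 0 & forall g, g \in G -> rW g *m A = A *m rU g) <->
  \sum_(g in G) \tr (rW g^-1%g) * \tr (rU g) != 0.
Proof.
set L := lin_mx hom_average; have LL : L *m L = L.
  apply/row_matrixP => i; rewrite row_mul [row i L]rowE.
  rewrite -[delta_mx 0 i]vec_mxK !mul_vec_lin /= hom_average_id // => g Gg.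
  exact: hom_averageJ.
have -> : (\sum_(g in G) \tr (rW g^-1%g) * \tr (rU g) != 0) = (L != 0).
  rewrite -mxrank_eq0 -natf_eq0 -mxtrace_idempotent //.
  by rewrite mxtrace_hom_average mulf_eq0 invr_eq0 (negPf nz_G).
split=> [[A nzA homA]|nzL].
  apply: contraNneq nzA => L0; rewrite -[A]mxvecK -(hom_average_id homA).
  by rewrite -mul_vec_lin -/L L0 mulmx0 linear0.
have [i nz_i] : exists i, row i L != 0.
  apply/existsP; apply: contraR nzL => /existsPn L0; apply/eqP/row_matrixP => i.
  by apply/eqP; have := L0 i; rewrite negbK row0.
exists (hom_average (vec_mx (delta_mx 0 i))); last exact: hom_averageJ.
apply: contraNneq nz_i => A0; rewrite rowE -[delta_mx 0 i]vec_mxK.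
by rewrite mul_vec_lin /= A0 linear0.
Qed.
End Average.

(** Schur: the kernel of a nonzero intertwiner from an irreducible
    representation is a proper submodule, hence zero. *)
Lemma irr_hom_submod m n (rW : mx_representation F G m)
    (rU : mx_representation F G n) (A : 'M_(m, n)) :
    mx_irreducible rW -> A != 0 ->
    (forall g, g \in G -> rW g *m A = A *m rU g) ->
  exists (M : 'M_n) (modM : mxmodule rU M), mx_rsim rW (submod_repr modM).
Proof.
move=> irrW nzA homA.
have freeA : row_free A.
  rewrite -kermx_eq0; apply: contraNT nzA => nzK.
  have modK : mxmodule rW (kermx A).
    apply/mxmoduleP => g Gg; apply/sub_kermxP.
    by rewrite -mulmxA homA // mulmxA mulmx_ker mul0mx.
  have [_ /(_ _ modK nzK)] := (mx_irrP rW).1 irrW.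
  by rewrite -sub1mx => /sub_kermxP; rewrite mul1mx => ->.
have modM : mxmodule rU <<A>>%MS.
  rewrite (eqmx_module _ (genmxE A)); apply/mxmoduleP => g Gg.
  by rewrite -homA // submxMl.
exists <<A>>%MS, modM.
have AM : (A <= <<A>>)%MS by rewrite genmxE.
exists (in_submod <<A>>%MS A).
- by rewrite genmxE; apply/esym/eqP.
- apply/row_freeP; have /row_freeP[D AD] := freeA.
  exists (val_submod 1%:M *m D).
  by rewrite mulmxA -val_submodE in_submodK.
move=> g Gg; have val_inj := can_inj (val_submodK (U := <<A>>%MS)).
apply: val_inj; rewrite val_submodJ // in_submodK // -homA //.
by rewrite val_submodE -mulmxA -val_submodE in_submodK.
Qed.

(** A complement [U'] of the submodule is provided by Maschke's theorem. *)
Lemma rep_class_submod n (rU : mx_representation F G n) (M : 'M_n)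
    (modM : mxmodule rU M) :
  exists2 U' : representation F G, rdegree U' = (n - \rank M)%N &
  rep_class (Representation rU) =
    rep_class (Representation (submod_repr modM)) + rep_class U'.
Proof.
have pG : pgroup [pchar F]^' G by apply/pgroupP=> p _ _; rewrite inE /= charF0.
have [V modV defV dxV] := mx_Maschke_pchar rU pG modM (submx1 M).
exists (Representation (submod_repr modV)) => /=.
  have := mxdirectP dxV; rewrite /= defV mxrank1.
  by move/(congr1 (subn^~ (\rank M))) ->; rewrite addKn.
rewrite -rep_class_dsum; apply: rep_class_iso.
have rsimM := mx_rsim_refl (submod_repr modM).
have rsimV := mx_rsim_refl (submod_repr modV).
have rsim1 := mx_rsim_sym (rsim_submod1 (mxmodule1 rU) (eqmx_refl _)).
apply: mx_rsim_trans rsim1 _.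
exact: (@mx_rsim_dadd _ _ _ _ _ _ _ _ (Representation (submod_repr modM))
         (Representation (submod_repr modV)) modM modV _ defV dxV rsimM rsimV).
Qed.

(** Induction on the degree. A simple submodule [M] of [U] embeds in [V], since
    by [hom_trace_neq0] the traces decide whether it has a nonzero map to either
    one. Splitting [M] off both sides leaves complements with equal traces. *)
Theorem rep_class_eq_trace (U V : representation F G) :
  {in G, forall g, \tr (U g) = \tr (V g)} -> rep_class U = rep_class V.
Proof.
have [d] := ubnP (rdegree U).
elim: d U V => // d IHd [m rU] [n rV] /= lt_md trUV.
have [m0|m_gt0] := posnP m.
  have n0 : n = 0.
    apply/eqP; rewrite -natf_eq0 -(mxtrace1 F) -(repr_mx1 rV) -trUV //.
    by rewrite repr_mx1 mxtrace1 m0.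
  rewrite {}m0 {}n0 in rU rV {lt_md trUV} *; apply: rep_class_iso.
  exists 1%:M; rewrite ?row_free_unit ?unitmx1 // => g Gg.
  by rewrite [LHS]flatmx0 [RHS]flatmx0.
have nz1 : 1%:M != 0 :> 'M[F]_m by rewrite -mxrank_eq0 mxrank1 -lt0n.
apply/eqP; apply: (mxsimple_exists (mxmodule1 rU) nz1) => -[M simM _].
apply/eqP.
have [modM nzM _] := simM.
have irrM : mx_irreducible (submod_repr modM) by apply/submod_mx_irr.
have : exists2 A : 'M_(\rank M, n), A != 0 &
    forall g, g \in G -> submod_repr modM g *m A = A *m rV g.
  apply/hom_trace_neq0; rewrite -(eq_bigr _ (fun g Gg => congr1 _ (trUV g Gg))).
  apply/hom_trace_neq0; exists (row_base M) => [|g Gg].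
    by rewrite -mxrank_eq0 eq_row_base mxrank_eq0.
  by have := val_submodJ modM 1%:M Gg; rewrite /val_submod /= !mul1mx.
case=> A nzA /(irr_hom_submod irrM nzA)[N [modN simMN]].
have [U' dU' defU] := rep_class_submod modM.
have [V' _ defV] := rep_class_submod modN.
rewrite defU defV (rep_class_iso (U := Representation (submod_repr modM))
  (V := Representation (submod_repr modN)) simMN).
congr (_ + _); apply: IHd => [|g Gg].
  rewrite dU' (leq_trans _ (lt_md : m <= d)%N) // ltn_subrL m_gt0 lt0n.
  by rewrite mxrank_eq0 nzM.
apply: (addrI (\tr (submod_repr modM g))).
have rsimE := mxtrace_rsim simMN Gg.
have := congr1 (rep_char Gg) defU; have := congr1 (rep_char Gg) defV.
rewrite !rmorphD /= !rep_char_class /= => trV trU.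
by rewrite -trU trUV //= trV -rsimE.
Qed.

(** Every element of the representation ring is a difference of two classes, so
    that the case of classes is enough. *)
Theorem rep_char_inj (u v : rep_ring F G) :
  (forall g (Gg : g \in G), rep_char Gg u = rep_char Gg v) -> u = v.
Proof.
have split_class w :
    exists U V : representation F G, w = rep_class U - rep_class V.
  pose T := triv_grepr F G.
  rewrite -(rep_reprK w); elim: (rep_repr w) => {w}.
  - move=> U; exists (dadd_grepr U T), T.
    by rewrite rep_class_dsum addrK.
  - by exists T, T; rewrite subrr.
  - exists (dadd_grepr T T), T.
    by rewrite rep_class_dsum addrK rep_class_triv.
  - move=> x [U [V xE]]; exists V, U.
    by rewrite -[rep_pi _](rep_oppE x) xE; exact: opprB.
  - move=> x [U [V xE]] y [U' [V' yE]].
    exists (dadd_grepr U U'), (dadd_grepr V V').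
    by rewrite -[rep_pi _](rep_addE x y) xE yE !rep_class_dsum opprD addrACA.
  move=> x [U [V xE]] y [U' [V' yE]].
  exists (dadd_grepr (tens_grepr U U') (tens_grepr V V')),
         (dadd_grepr (tens_grepr U V') (tens_grepr V U')).
  rewrite -[rep_pi _](rep_mulE x y) xE yE !rep_class_dsum !rep_class_tens.
  have mulBB (a b c d : rep_ring F G) :
    (a - b) * (c - d) = a * c + b * d - (a * d + b * c) by ring.
  exact: mulBB.
have [U [V ->]] := split_class u; have [U' [V' ->]] := split_class v => eq_uv.
apply/eqP; rewrite subr_eq addrAC eq_sym subr_eq -!rep_class_dsum; apply/eqP.
apply/esym/rep_class_eq_trace => g Gg; have /eqP := eq_uv g Gg.
rewrite !rmorphB /= !rep_char_class subr_eq addrAC eq_sym subr_eq => /eqP E.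
by rewrite !mxtrace_block.
Qed.
End Intertwiners.

(** * Fibonomial coefficients at s = x + y and t = - x y *)

Section Evaluation.
Variables (A : comNzRingType) (x y : A).

(** The polynomial comes last, for the ring morphism structure in [P]. *)
Definition eval_at (P : {poly {poly int}}) : A := eval_ZXY P x y.

Fact eval_at_zmod_morphism : zmod_morphism eval_at.
Proof. by move=> P Q; rewrite /eval_at /eval_ZXY rmorphB /= !hornerE. Qed.

Fact eval_at_monoid_morphism : monoid_morphism eval_at.
Proof.
by split=> [|P Q]; rewrite /eval_at /eval_ZXY ?(rmorph1, rmorphM) /= !hornerE.
Qed.

HB.instance Definition _ := GRing.isZmodMorphism.Build {poly {poly int}} A
  eval_at eval_at_zmod_morphism.
HB.instance Definition _ := GRing.isMonoidMorphism.Build {poly {poly int}} A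
  eval_at eval_at_monoid_morphism.

Lemma eval_at_X : eval_at 'X = x.
Proof. by rewrite /eval_at /eval_ZXY map_polyX !hornerE. Qed.

Lemma eval_at_Y : eval_at 'Y = y.
Proof. by rewrite /eval_at /eval_ZXY map_polyC /= map_polyX !hornerE. Qed.
End Evaluation.

Lemma eval_ZXY_rmorph (A B : comNzRingType) (f : {rmorphism A -> B}) P x y :
  f (eval_ZXY P x y) = eval_ZXY P (f x) (f y).
Proof.
rewrite /eval_ZXY -horner_map -horner_map /= -map_poly_comp /= map_polyC /=.
congr (_.[_].[_]); apply: eq_map_poly => p /=; rewrite -map_poly_comp /=.
by apply: eq_map_poly => z /=; rewrite rmorph_int.
Qed.

Lemma fibonomial_addK a b :
  fibonomial (a + b) b * (fib_fact b * fib_fact a) = fib_fact (a + b).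
Proof. by rewrite -[in RHS](fibonomialK (leq_addl a b)) addnK. Qed.

(** This is the recursion behind the divisibility of the factorials: unlike the
    Pascal rule of [qbinS], it has coefficients in [Z[s, t]]. It comes from
    splitting the top factor by [fib_polyD]. *)
Lemma fibonomial_rec a b :
  fibonomial (a.+1 + b.+1) b.+1 =
    fib_poly b.+2 * fibonomial (a + b.+1) b.+1
    + 'Y * fib_poly a * fibonomial (a.+1 + b) b.
Proof.
have /mulIf : fib_fact b.+1 * fib_fact a.+1 != 0.
  by rewrite monic_neq0 // monicMl ?fib_fact_monic.
apply; rewrite fibonomial_addK mulrDl addSn fib_factS -addSn fib_polyD mulrDl.
rewrite -[in X in _ * _ * X + _]fibonomial_addK addSnnS -addSnnS.
rewrite -[in X in _ + _ * X]fibonomial_addK !fib_factS; ring.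
Qed.

Section QBinomial.
Variables (A : comNzRingType) (x y : A).

(** The homogeneous q-integer [(x^m - y^m) / (x - y)], without the division. *)
Fixpoint qint (m : nat) : A := if m is p.+1 then x ^+ p + y * qint p else 0.

(** The homogeneous q-binomial coefficient [a + b] choose [b], defined by a
    Pascal rule so that it makes sense even where q-integers vanish. *)
Fixpoint qbin (a : nat) : nat -> A :=
  if a is a'.+1 then
    fix qbin_a b :=
      if b is b'.+1 then x ^+ b * qbin a' b + y ^+ a * qbin_a b' else 1
  else fun=> 1.

Lemma qint0 : qint 0 = 0. Proof. by []. Qed.

Lemma qintSl m : qint m.+1 = x ^+ m + y * qint m. Proof. by []. Qed.

Lemma qbin0r a : qbin a 0 = 1. Proof. by case: a. Qed.

Lemma qbin0l b : qbin 0 b = 1. Proof. by []. Qed.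

Lemma qbinS a b :
  qbin a.+1 b.+1 = x ^+ b.+1 * qbin a b.+1 + y ^+ a.+1 * qbin a.+1 b.
Proof. by []. Qed.

Arguments qint : simpl never.
Arguments qbin : simpl never.

Lemma qintSr m : qint m.+1 = y ^+ m + x * qint m.
Proof.
elim: m => [|m IHm]; first by rewrite qintSl qint0 !mulr0.
by rewrite qintSl {1}IHm [in RHS]qintSl !exprS; ring.
Qed.

Lemma qintD a b : qint (a + b) = x ^+ b * qint a + y ^+ a * qint b.
Proof.
elim: a => [|a IHa]; first by rewrite qint0 mulr0 mul1r add0r.
by rewrite addSn !qintSl IHa exprD exprS; ring.
Qed.

Lemma eval_fib_poly m : eval_at (x + y) (- (x * y)) (fib_poly m) = qint m.
Proof.
elim/ltn_ind: m => -[|[|m]] IHm.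
- by rewrite rmorph0.
- by rewrite rmorph1 qintSl qint0 mulr0 addr0.
rewrite fib_polySS; have := IHm m.+1 (ltnSn _); move: (fib_poly m.+1) => P IH1.
rewrite rmorphD !rmorphM /= eval_at_X eval_at_Y IHm // IH1.
by rewrite !qintSl exprS; ring.
Qed.

(** Each equation at [(a, b)] needs both of them at a smaller pair, whence the
    joint induction on [a + b]. *)
Lemma qbin_absorb a b :
  qint a.+1 * qbin a.+1 b = qint (a + b).+1 * qbin a b /\
  qint b.+1 * qbin a b.+1 = qint (a + b).+1 * qbin a b.
Proof.
have [k] := ubnP (a + b)%N; elim: k a b => // k IHk a b lt_ab_k.
split.
  case: b lt_ab_k => [|b] lt_ab_k; first by rewrite !qbin0r addn0.
  have [] := IHk a b; first by rewrite addnS in lt_ab_k.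
  move=> Da Db; rewrite qbinS -addSn qintD.
  rewrite mulrDr mulrCA (mulrCA (qint a.+1) (y ^+ _)) Da -Db; ring.
case: a lt_ab_k => [|a] lt_ab_k; first by rewrite !qbin0l !mulr1.
have [] := IHk a b; first by rewrite addSn in lt_ab_k.
move=> Da Db; rewrite qbinS -addnS qintD.
rewrite mulrDr mulrCA Db -Da; ring.
Qed.

(** The two sides satisfy different recursions, [fibonomial_rec] and [qbinS].
    Their coefficients differ by [y * qint b.+1] and [- y * qint a.+1], and
    these two terms cancel by [qbin_absorb]. *)
Lemma eval_fibonomial a b :
  eval_at (x + y) (- (x * y)) (fibonomial (a + b) b) = qbin a b.
Proof.
have nz_fact c : fib_fact c != 0 by rewrite monic_neq0 ?fib_fact_monic.
elim: a b => [|a IHa]; last elim=> [|b IHb].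
- move=> b; have -> : fibonomial (0 + b) b = 1; last by rewrite rmorph1.
  by apply: (mulIf (nz_fact b)); rewrite mul1r -[RHS](fibonomial_addK 0 b);
     rewrite fib_fact0 mulr1.
- have -> : fibonomial (a.+1 + 0) 0 = 1; last by rewrite rmorph1.
  apply: (mulIf (nz_fact a.+1)).
  rewrite mul1r -[in RHS](addn0 a.+1) -[RHS](fibonomial_addK a.+1 0).
  by rewrite fib_fact0 mul1r.
rewrite fibonomial_rec; have := eval_fib_poly b.+2.
move: (fib_poly b.+2) => P evP.
rewrite rmorphD !rmorphM /= eval_at_Y evP eval_fib_poly IHa IHb.
have [Da Db] := qbin_absorb a b.
have E : qint a.+1 * qbin a.+1 b = qint b.+1 * qbin a b.+1 by rewrite Da Db.
rewrite qbinS (qintSl b.+1) mulrDl -(mulrA y) -E (qintSr a) !exprS; ring.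
Qed.

(** The q-binomial theorem, modulo ['X^(k+1)]: the [qbin a b] are the complete
    homogeneous symmetric functions of [x^j y^(a-j)] for [0 <= j <= a]. For the
    induction, the Pascal rule says that multiplying the series for [a + 1] by
    [1 - y^(a+1) X] gives the series for [a] at [x X]. *)
Lemma qbin_series a k :
  exists r, (\prod_(j < a.+1) (1 - (x ^+ j * y ^+ (a - j)) *: 'X))
    * \poly_(b < k.+1) qbin a b = 1 + 'X^(k.+1) * r.
Proof.
elim: a => [|a [r IHa]].
  exists (-1); rewrite big_ord1 expr0 mul1r scale1r poly_def.
  under eq_bigr do rewrite scale1r.
  by rewrite -opprB mulNr -subrX1 opprB mulrN1.
pose G := \poly_(b < k.+1) qbin a.+1 b.
(* The last term is the overflow of the truncation in degree k + 1. *)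
have GE : (1 - y ^+ a.+1 *: 'X) * G =
    (\poly_(b < k.+1) qbin a b) \Po (x *: 'X)
      + 'X^(k.+1) * (- y ^+ a.+1 * qbin a.+1 k)%:P.
  have -> : (\poly_(b < k.+1) qbin a b) \Po (x *: 'X) =
      \poly_(b < k.+1) (x ^+ b * qbin a b).
    rewrite !poly_def linear_sum; apply: eq_bigr => b _ /=.
    by rewrite comp_polyZ rmorphXn /= comp_polyX exprZn scalerA mulrC.
  apply/polyP => i; rewrite mulrBl mul1r -scalerAl !coefE.
  case: i => [|i] /=.
    by rewrite !qbin0r expr0 mulr0 mul0r subr0 addr0 mul1r.
  rewrite !ltnS eqSS; have [lt_ik|lt_ki|->] := ltngtP i k.
  - by rewrite qbinS mul0r addr0 addrK.
  - by rewrite mulr0 mul0r subr0 addr0.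
  by rewrite sub0r add0r mul1r mulNr.
pose r' := (r \Po (x *: 'X)).
exists (x ^+ k.+1 *: r'
  + (\prod_(j < a.+1) (1 - (x ^+ j.+1 * y ^+ (a - j)) *: 'X))
    * (- y ^+ a.+1 * qbin a.+1 k)%:P).
rewrite big_ord_recl mulrAC expr0 mul1r subn0 GE mulrC.
rewrite (eq_bigr (fun j : 'I_a.+1 => 1 - (x ^+ j.+1 * y ^+ (a - j)) *: 'X)) //.
rewrite mulrDr.
have := congr1 (comp_poly (x *: 'X)) IHa.
rewrite rmorphM rmorph_prod rmorphD rmorphM rmorphXn rmorph1 /= comp_polyX.
rewrite exprZn.
rewrite (eq_bigr (fun j : 'I_a.+1 => 1 - (x ^+ j.+1 * y ^+ (a - j)) *: 'X));
  last first.
  move=> j _; rewrite rmorphB rmorph1 /= comp_polyZ comp_polyX scalerA.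
  by rewrite exprSr mulrAC.
move=> ->; rewrite -scalerAl -/r' scalerAr; ring.
Qed.
End QBinomial.

(** * Power series inverses up to a fixed degree *)

Section TruncatedInverse.
Variables (A : comNzRingType) (k : nat).

Definition truncated_inverse (D P : {poly A}) :=
  exists r, D * P = 1 + 'X^(k.+1) * r.

Lemma truncated_inverse1 : truncated_inverse 1 1.
Proof. by exists 0; rewrite mulr0 addr0 mulr1. Qed.

Lemma truncated_inverseM D P D' P' :
  truncated_inverse D P -> truncated_inverse D' P' ->
  truncated_inverse (D * D') (P * P').
Proof.
move=> [r DP] [r' DP']; exists (r + r' + 'X^(k.+1) * r * r').
by rewrite mulrACA DP DP'; ring.
Qed.

(** Both [P] and [P'] agree with [P * D * P'] up to degree [k]. *)
Lemma truncated_inverse_coef D P P' :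
  truncated_inverse D P -> truncated_inverse D P' -> P`_k = P'`_k.
Proof.
move=> [r DP] [r' DP'].
have coef_mod (p q : {poly A}) : (p + 'X^(k.+1) * q)`_k = p`_k.
  by rewrite coefD coefXnM ltnSn addr0.
rewrite -(coef_mod P (P * r')) -(coef_mod P' (P' * r)).
suff -> : P + 'X^(k.+1) * (P * r') = P' + 'X^(k.+1) * (P' * r) by [].
transitivity (P * (D * P')); first by rewrite DP'; ring.
by rewrite mulrCA mulrA DP; ring.
Qed.

Lemma geometric_truncated_inverse w :
  (0 < w)%N -> truncated_inverse (1 - 'X^w) (\sum_(j < k.+1) 'X^(w * j)).
Proof.
move=> w_gt0; exists (- 'X^(w.-1 * k.+1)).
rewrite mulrN -exprD -mulSn prednK // exprM.
under eq_bigr do rewrite exprM.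
by rewrite -opprB mulNr -subrX1 opprB.
Qed.
End TruncatedInverse.

(** * Multisubsets fixed by a group element *)

Section FixedMultisubsets.
Variables (gT : finGroupType) (T : finType) (to : {action gT &-> T}).
Variables (k : nat) (g : gT).

Local Notation mact := (multisubset_action to k).
Local Notation orb := (orbit to <[g]>%g).
Local Notation orbs := (orb @: [set: T]).

Lemma orbs_neq0 O : O \in orbs -> (0 < #|O|)%N.
Proof.
by case/imsetP=> x _ ->; apply/card_gt0P; exists x; apply: orbit_refl.
Qed.

Lemma sum_over_orbits (f : {set T} -> nat) :
  (\sum_x f (orb x) = \sum_(O in orbs) #|O| * f O)%N.
Proof.
rewrite (partition_big orb (mem orbs)) => [|x _]; last exact: imset_f.
apply: eq_bigr => _ /imsetP[y _ ->].
rewrite (eq_bigr (fun=> f (orb y))) => [|x /eqP->] //; rewrite sum_nat_const.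
congr (_ * _)%N; apply: eq_card => x; transitivity (orb x == orb y) => //.
by apply/eqP/idP => [<-|/orbit_eqP ->//]; apply: orbit_refl.
Qed.

Lemma fixed_multisubsetP (m : multisubset T k) :
  reflect (forall x y, orb x = orb y -> val m x = val m y)
    (m \in 'Fix_mact[g]%g).
Proof.
apply: (iffP idP) => [fix_m x y /orbit_eqP/orbitP[h gh <-] | const_m].
  have : m \in 'Fix_mact(<[g]>)%g by rewrite afix_cycle.
  move/afixP/(_ _ gh)/(congr1 val)/ffunP/(_ (to y h)).
  by rewrite ffunE actK.
apply/afix1P/val_inj/ffunP => x; rewrite ffunE; apply: const_m.
by apply/orbit_eqP/mem_orbit; rewrite groupV cycle_id.
Qed.

(** A fixed multisubset is constant on the orbits of [g], hence amounts to one
    multiplicity for each orbit. A function on the set of orbits is encoded as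
    a function on all sets of points that vanishes outside of it. *)
Lemma card_fixed_multisubsets :
  #|'Fix_mact[g]%g| =
  #|[set f in pffun_on (ord0 : 'I_k.+1) (mem orbs) predT |
      (\sum_(O in orbs) #|O| * f O)%N == k]|.
Proof.
pose spread (f : {ffun {set T} -> 'I_k.+1}) : {ffun T -> 'I_k.+1} :=
  [ffun x => f (orb x)].
rewrite -(card_imset _ val_inj) -[RHS](card_in_imset (f := spread)); last first.
  move=> f f'; rewrite !inE => /andP[/pffun_onP[/supportP f0 _] _].
  move=> /andP[/pffun_onP[/supportP f0' _] _] /ffunP eq_ff'; apply/ffunP => O.
  have [/imsetP[x _ ->]|nO] := boolP (O \in orbs); last by rewrite f0 ?f0'.
  by have := eq_ff' x; rewrite !ffunE.
congr #|pred_of_set _|; apply/setP => f; apply/imsetP/imsetP => -[].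
  move=> m /fixed_multisubsetP const_m ->.
  pose h : {ffun {set T} -> 'I_k.+1} := [ffun O => if O \in orbs then
    if [pick x in O] is Some x then val m x else ord0 else ord0].
  have hE x : h (orb x) = val m x.
    rewrite ffunE imset_f //; case: pickP => [y yx|/(_ x)].
      by apply: const_m; apply/orbit_eqP.
    by rewrite orbit_refl.
  exists h; last by apply/ffunP => x; rewrite ffunE hE.
  rewrite inE -sum_over_orbits; apply/andP; split.
    apply/pffun_onP; split=> //; apply/supportP => O nO.
    by rewrite ffunE (negPf nO).
  rewrite (eq_bigr (fun x => val m x : nat)) ?(eqP (valP m)) // => x _.
  by rewrite hE.
move=> h; rewrite inE => /andP[_ sum_h] ->.
have spread_sum : (\sum_x (spread h x : nat) == k)%N.
  apply/eqP; transitivity (\sum_x (h (orb x) : nat))%N.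
    by apply: eq_bigr => x _; rewrite ffunE.
  by rewrite (sum_over_orbits (fun O => h O)); apply/eqP.
exists (exist _ (spread h) spread_sum : multisubset T k) => //.
by apply/fixed_multisubsetP => x y /= eq_xy; rewrite !ffunE eq_xy.
Qed.

Lemma fixed_multisubsets_coef (A : comNzRingType) :
  #|'Fix_mact[g]%g|%:R =
  (\prod_(O in orbs) \sum_(j < k.+1) 'X^(#|O| * j) : {poly A})`_k.
Proof.
rewrite (big_distr_big ord0) /= coef_sum card_fixed_multisubsets.
rewrite -sum1_card natr_sum big_mkcond [RHS]big_mkcond; apply: eq_bigr => f _.
rewrite inE; case: ifP => [/andP[-> sum_f]|].
  by rewrite -expr_sum coefXn eq_sym sum_f.
case: ifP => //= _ ne_k; rewrite -expr_sum coefXn eq_sym.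
by rewrite ne_k.
Qed.

(** The product over the orbits is [det (1 - X g)] for the permutation matrix of
    [g], so that the hypothesis says that the eigenvalues of [g] on the points
    are the [x^j y^(a-j)]. The numbers of fixed multisubsets and the q-binomial
    coefficients are then coefficients of inverses of the same polynomial. *)
Lemma card_fixed_multisubsets_qbin (A : comNzRingType) (x y : A) a :
  \prod_(O in orbs) (1 - 'X^#|O|) =
    \prod_(j < a.+1) (1 - (x ^+ j * y ^+ (a - j)) *: 'X) ->
  #|'Fix_mact[g]%g|%:R = qbin x y a k.
Proof.
move=> eq_det; rewrite fixed_multisubsets_coef.
have -> : qbin x y a k = (\poly_(b < k.+1) qbin x y a b)`_k.
  by rewrite coef_poly ltnSn.
apply: (@truncated_inverse_coef _ _ (\prod_(O in orbs) (1 - 'X^#|O|))).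
  apply: (big_ind2 (truncated_inverse k)) => [||O /orbs_neq0].
  - exact: truncated_inverse1.
  - by move=> *; apply: truncated_inverseM.
  exact: geometric_truncated_inverse.
by rewrite eq_det; apply: qbin_series.
Qed.
End FixedMultisubsets.

(** * Products over roots of unity *)

Section RootProducts.
Variable F : fieldType.

(** This is the factorization of ['X^d - 1] with the roles of the two terms
    exchanged; the factors [- z^j] which are pulled out have product [-1]
    because [d] is odd. *)
Lemma prod_1_sub_root d (z : F) (p : {poly F}) : d.-primitive_root z -> odd d ->
  \prod_(j < d) (1 - z ^+ j *: p) = 1 - p ^+ d.
Proof.
move=> prim_z odd_d.
have zd1 := prim_expr_order prim_z; have d_gt0 := prim_order_gt0 prim_z.
have nz_z : z != 0 by rewrite (prim_root_eq0 prim_z) -lt0n.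
have prim_zV : d.-primitive_root z^-1.
  have -> : z^-1 = z ^+ d.-1.
    by apply: (mulfI nz_z); rewrite -exprS prednK // zd1 divff.
  by rewrite prim_root_exp_coprime // coprimePn.
have -> : \prod_(j < d) (1 - z ^+ j *: p) =
    \prod_(j < d) (- z ^+ j)%:P * \prod_(j < d) (p - (z^-1 ^+ j)%:P).
  rewrite -big_split; apply: eq_bigr => j _ /=.
  rewrite polyCN mulNr mulrBr -polyCM exprVn divff ?expf_neq0 // opprB.
  by rewrite mul_polyC.
have -> : \prod_(j < d) (p - (z^-1 ^+ j)%:P) = p ^+ d - 1.
  have := congr1 (comp_poly p) (factor_Xn_sub_1 prim_zV).
  rewrite big_mkord rmorph_prod rmorphB rmorph1 rmorphXn /= comp_polyX => <-.
  by apply: eq_bigr => j _; rewrite comp_polyB comp_polyX comp_polyC.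
rewrite -rmorph_prod /= prodrN card_ord -signr_odd odd_d expr1.
have -> : \prod_(j < d) z ^+ j = 1.
  rewrite -expr_sum -(big_mkord predT id) bin2_sum bin2odd //.
  by rewrite exprM zd1 expr1n.
by rewrite mulr1 polyCN mulNr mul1r opprB.
Qed.

Lemma prod_periodic (A : comNzRingType) (f : nat -> A) d m :
  (forall j, f (d + j)%N = f j) ->
  \prod_(j < m * d) f j = (\prod_(j < d) f j) ^+ m.
Proof.
move=> per_f; elim: m => [|m IHm]; first by rewrite mul0n big_ord0.
rewrite mulSn big_split_ord /= exprS -IHm; congr (_ * _).
by apply: eq_bigr => j _; rewrite per_f.
Qed.

(** As [z^(n+1) = 1], the coefficients are [z^(2j+1) = z (z^2)^j], and [z^2] is
    again a primitive [d]-th root because [d] is odd. Each period of length [d]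
    contributes one factor [1 - (z X)^d = 1 - X^d]. *)
Lemma rotation_root_product d n (z : F) :
  d.-primitive_root z -> odd d -> (d %| n.+1)%N ->
  \prod_(j < n.+1) (1 - (z ^+ j * z^-1 ^+ (n - j)) *: 'X) =
  (1 - 'X^d) ^+ (n.+1 %/ d).
Proof.
move=> prim_z odd_d dvd_dn; have zd1 := prim_expr_order prim_z.
have nz_z : z != 0.
  by rewrite (prim_root_eq0 prim_z) -lt0n (prim_order_gt0 prim_z).
pose w := z ^+ 2; have prim_w : d.-primitive_root w.
  by rewrite prim_root_exp_coprime // coprime2n.
rewrite (eq_bigr (fun j : 'I_n.+1 => 1 - w ^+ j *: (z *: 'X))) => [|j _];
  last first.
  congr (1 - _); rewrite scalerA; congr (_ *: _).
  apply: (@mulIf _ (z ^+ (n - j))); first by rewrite expf_neq0.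
  rewrite exprVn mulfVK ?expf_neq0 // -exprM -exprSr -exprD.
  apply/eqP; rewrite (eq_prim_root_expr prim_z).
  have -> : ((2 * j).+1 + (n - j) = n.+1 + j)%N by have := ltn_ord j; lia.
  by rewrite eq_sym eqn_mod_dvd ?leq_addl // addnK.
have per j : 1 - w ^+ (d + j) *: (z *: 'X) = 1 - w ^+ j *: (z *: 'X).
  by rewrite exprD (prim_expr_order prim_w) mul1r.
have := prod_periodic (n.+1 %/ d) per; rewrite divnK // => ->.
by rewrite prod_1_sub_root // exprZn zd1 scale1r.
Qed.

Lemma reflection_root_product m :
  \prod_(j < m.*2.+1) (1 - (1 ^+ j * (-1) ^+ (m.*2 - j)) *: 'X) =
  (1 - 'X) * (1 - 'X^2) ^+ m :> {poly F}.
Proof.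
rewrite (eq_bigr (fun j : 'I_m.*2.+1 => 1 - (-1) ^+ j *: 'X)) => [|j _];
  last first.
  rewrite expr1n mul1r -signr_odd oddB ?odd_double ?signr_odd //.
  by rewrite -ltnS.
rewrite big_ord_recl expr0 scale1r; congr (_ * _).
have per j : 1 - (-1) ^+ (2 + j).+1 *: 'X = 1 - (-1) ^+ j.+1 *: 'X :> {poly F}.
  by rewrite -addnS exprD sqrrN expr1n mul1r.
rewrite -muln2; have := prod_periodic m per; rewrite /bump /= => ->.
rewrite !big_ord_recl big_ord0 /= mulr1; congr (_ ^+ _).
by rewrite expr1 sqrrN expr1n scaleN1r scale1r; ring.
Qed.
End RootProducts.

(** * Roots of unity from the trigonometric functions *)

Section Cis.
Variable R : realType.

Definition cis (t : R) : R[i] := cos t +i* sin t.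

Lemma cisD s t : cis (s + t) = cis s * cis t.
Proof.
rewrite /cis cosD sinD; apply/eqP.
by rewrite eq_complex /= [X in _ && (X == _)]addrC !eqxx.
Qed.

Lemma cis0 : cis 0 = 1. Proof. by rewrite /cis cos0 sin0. Qed.

Lemma cisMn t m : cis (t *+ m) = cis t ^+ m.
Proof. by elim: m => [|m IHm]; rewrite ?cis0 // mulrS exprS cisD IHm. Qed.

Lemma cis_mulN t : cis t * cis (- t) = 1.
Proof. by rewrite -cisD subrr cis0. Qed.

Lemma cis_neq0 t : cis t != 0.
Proof.
have /eqP := cis_mulN t; apply: contraTneq => ->.
by rewrite mul0r eq_sym oner_eq0.
Qed.

Lemma cisV t : (cis t)^-1 = cis (- t).
Proof. exact/mulr1_eq/cis_mulN. Qed.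

(** If [cos t = 1] then [sin (t / 2) = 0] by the double angle formula. *)
Lemma cis_neq1 t : 0 < t < 2 * pi -> cis t != 1.
Proof.
move=> /andP[t_gt0 t_lt2pi]; rewrite eq_complex /= negb_and.
have sin_gt0 : 0 < sin (t / 2).
  by apply: sin_gt0_pi; rewrite divr_gt0 //= ltr_pdivrMr // mulrC.
rewrite {1}[t](_ : _ = (t / 2) *+ 2) ?cos_mulr2n; last first.
  by rewrite -mulr_natr divfK ?pnatr_eq0.
rewrite cos2sin2.
have : 0 < sin (t / 2) ^+ 2 by rewrite exprn_gt0.
by move: (_ ^+ 2) => u u0; apply/orP; left; apply/eqP => h; lra.
Qed.

Lemma cis_prim_root n : (0 < n)%N -> n.-primitive_root (cis (2 * pi / n%:R)).
Proof.
move=> n_gt0; rewrite /primitive_root_of_unity n_gt0; apply/forallP => j.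
have nR : 0 < n%:R :> R by rewrite ltr0n.
rewrite unity_rootE -cisMn; apply/eqP.
rewrite -[_ *+ j.+1]mulr_natr; have [->|ne] := eqVneq j.+1 n.
  by rewrite divfK ?pnatr_eq0 -?lt0n // /cis mulr_natl cos2pi sin2pi eqxx.
have pi2_gt0 : 0 < 2 * pi :> R by rewrite mulr_gt0 ?pi_gt0.
apply/negbTE/cis_neq1; rewrite !mulr_gt0 ?invr_gt0 ?pi_gt0 //=.
by rewrite mulrAC ltr_pdivrMr // ltr_pM2l // ltr_nat ltn_neqAle ne /=.
Qed.
End Cis.

(** * Orbits and characters of the dihedral group *)

Lemma mxtrace_permutation (F : fieldType) (gT : finGroupType) (X : finType)
    (to : {action gT &-> X}) g :
  \tr (permutation_mx F to g) = #|'Fix_to[g]%g|%:R.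
Proof.
rewrite /mxtrace -sum1_card natr_sum [RHS](reindex (@enum_val X X)) /=;
  last exact/onW_bij/enum_val_bij.
rewrite [RHS]big_mkcond; apply: eq_bigr => i _; rewrite mxE.
by rewrite (sameP afix1P eqP) eq_sym; case: eqP.
Qed.

Section DihedralOrbits.
Variables (n : nat) (A : comNzRingType).
Local Notation N := (Zp_trunc n).+2.
Local Notation to := (dihedral_action n).
Local Notation orbs g := (orbit to <[g : dihedral n]>%g @: [set: 'Z_n]).

Lemma mulrn_order (i : 'Z_n) : i *+ N = 0.
Proof. by apply: val_inj; rewrite Zp_mulrn /= modnMl. Qed.

Lemma rotationX (i : 'Z_n) m :
  (((i, false) : dihedral n) ^+ m)%g = (i *+ m, false) :> dihedral n.
Proof.
by elim: m => [|m IHm]; rewrite ?expg0 // expgS IHm dihedral_mulE mulrS.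
Qed.

Lemma orbs_partition g : partition (orbs g) [set: 'Z_n].
Proof. by apply/orbit_partition/actsP => h _ x; rewrite !inE. Qed.

Lemma order_rotation_dvd (i : 'Z_n) : (#[(i, false) : dihedral n]%g %| N)%N.
Proof. by rewrite order_dvdn rotationX mulrn_order. Qed.

(** Rotations other than the identity have no fixed vertex, so that the cyclic
    group generated by [g] acts freely and all orbits have [#[g]] elements. *)
Lemma rotation_orbit_product (i : 'Z_n) (g : dihedral n := (i, false)) :
  \prod_(O in orbs g) (1 - 'X^#|O|) =
    (1 - 'X^(#[g]%g)) ^+ (N %/ #[g]%g) :> {poly A}.
Proof.
have card_orb O : O \in orbs g -> #|O| = #[g]%g.
  case/imsetP=> x _ ->; rewrite card_orbit orderE.
  suff -> : ('C_<[g]>[x | to] = 1)%g by rewrite indexg1.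
  apply/trivgP/subsetP => h /setIP[/cycleP[m ->] /astab1P].
  rewrite rotationX /= /dihedral_act_fun /= => /(canRL (addKr x)).
  by rewrite addNr => ->; apply/set1P.
rewrite (eq_bigr (fun=> 1 - 'X^(#[g]%g))) => [|O /card_orb->] //.
rewrite prodr_const; congr (_ ^+ _).
have := card_uniform_partition card_orb (orbs_partition g).
by rewrite cardsT card_ord => /(congr1 (divn^~ #[g]%g)) ->; rewrite mulnK.
Qed.

(** A vertex [x] is fixed when [2 x = - i], and [(N + 1) / 2] is the inverse of
    2 modulo the odd number [N]. *)
Lemma reflection_fixed (i : 'Z_n) : odd N ->
  exists x0 : 'Z_n, forall x, (to x (i, true) == x) = (x == x0).
Proof.
move=> odd_N; have half2 (u : 'Z_n) : u *+ 2 *+ N./2.+1 = u.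
  rewrite -mulrnA (_ : (2 * N./2.+1)%N = N.+1); last first.
    by rewrite -[in RHS](odd_double_half N) odd_N; lia.
  by rewrite mulrS mulrn_order addr0.
exists (- i *+ N./2.+1) => x; rewrite /= /dihedral_act_fun /=.
apply/eqP/eqP => [xE | ->].
  rewrite -[LHS]half2; congr (_ *+ _).
  by rewrite mulr2n -{1}xE opprD addrAC addNr add0r.
have := half2 (- i); rewrite mulrnAC; move: (- i *+ _) => x0 x0E.
by rewrite opprD -x0E mulr2n addKr.
Qed.

(** One fixed vertex and [(N - 1) / 2] orbits of size 2. *)
Lemma reflection_orbit_product (i : 'Z_n) (g : dihedral n := (i, true)) :
  odd N ->
  \prod_(O in orbs g) (1 - 'X^#|O|) =
    (1 - 'X) * (1 - 'X^2) ^+ N./2 :> {poly A}.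
Proof.
move=> odd_N; have [x0 fix_x0] := reflection_fixed i odd_N.
have g2 : (g ^+ 2 = 1)%g by rewrite expgS expg1 dihedral_mulE /= subrr.
have orb_x0 : orbit to <[g]>%g x0 = [set x0].
  by apply/orbit1P; rewrite afix_cycle; apply/afix1P/eqP; rewrite fix_x0.
have card_orb O : O \in orbs g -> O != [set x0] -> #|O| = 2%N.
  case/imsetP=> x _ -> ne_x0.
  have : (#|orbit to <[g]>%g x| %| 2)%N.
    by rewrite (dvdn_trans (dvdn_orbit _ _ _)) // -orderE order_dvdn g2.
  case def_c: #|_| => [|[|[|c]]] // _.
  have orb_x := card_orbit1 def_c.
  case/eqP: ne_x0; rewrite orb_x; congr [set _].
  apply/eqP; rewrite -fix_x0; apply/eqP/afix1P; rewrite -afix_cycle.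
  exact/orbit1P.
have x0_orbs : [set x0] \in orbs g by rewrite -orb_x0 imset_f.
rewrite (bigD1 [set x0]) //= cards1; congr (_ * _).
rewrite (eq_bigr (fun=> 1 - 'X^2)) => [|O /andP[/card_orb cO /cO ->]] //.
rewrite prodr_const; congr (_ ^+ _).
have := card_partition (orbs_partition g); rewrite cardsT card_ord.
rewrite (bigD1 [set x0]) //= cards1 (eq_bigr (fun=> 2%N)); last first.
  by move=> O /andP[/card_orb cO /cO].
rewrite sum_nat_const muln2 => /(congr1 half)/esym.
rewrite (half_bit_double _ true) => halfN.
by apply: etrans halfN; apply: eq_card.
Qed.
End DihedralOrbits.

Section DihedralSieving.
Variables (R : realType) (n : nat).
Local Notation N := (Zp_trunc n).+2.

Lemma mxtrace_z1_rotation (i : 'Z_n) (z := cis (2 * pi / N%:R * i%:R : R)) :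
  \tr (z1 R n (i, false)) = z + z^-1.
Proof.
rewrite cisV /mxtrace /= /z1_mx mulmx1 !big_ord_recl big_ord0 !mxE /= addr0.
by apply/eqP; rewrite eq_complex /= cosN sinN subrr addr0 !eqxx.
Qed.

Lemma mxtrace_z1_reflection (i : 'Z_n) : \tr (z1 R n (i, true)) = 0.
Proof.
rewrite /mxtrace /= /z1_mx /= mul_mx_diag !big_ord_recl big_ord0 !mxE /= addr0.
by rewrite expr0 expr1 mulr1 mulrN1 subrr.
Qed.

Lemma mxtrace_det g : \tr (det_grepr R n g) = (-1) ^+ g.2.
Proof. by rewrite /= /det_mx mxtrace_scalar. Qed.

Lemma rotation_prim_root (i : 'Z_n) :
  #[(i, false) : dihedral n]%g.-primitive_root (cis (2 * pi / N%:R * i%:R : R)).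
Proof.
set g : dihedral n := (i, false); set z := cis _.
have zE : z = cis (2 * pi / N%:R) ^+ i by rewrite -cisMn -[_ *+ i]mulr_natr.
have z1E m : (z ^+ m == 1) = (#[g]%g %| m)%N.
  rewrite zE -exprM -(prim_order_dvd (cis_prim_root R (ltn0Sn _))) order_dvdn.
  by rewrite rotationX xpair_eqE andbT -val_eqE Zp_mulrn.
rewrite /primitive_root_of_unity order_gt0; apply/forallP => j.
rewrite unity_rootE z1E; apply/eqP; apply/idP/eqP => [dvd_gj|->//].
by apply/eqP; rewrite eqn_leq ltn_ord dvdn_leq.
Qed.
End DihedralSieving.

(** * Dihedral sieving for multisubsets *)

Theorem proposition4p8 (R : realType) (n k : nat) :
  (3 <= n)%N -> odd n ->
  dihedral_sieving R (multisubset_action (dihedral_action n) k)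
    (fibonomial (n + k - 1) k).
Proof.
move=> n_ge3 odd_n; have N_n : (Zp_trunc n).+2 = n by rewrite Zp_cast // ltnW.
have -> : (n + k - 1 = (Zp_trunc n).+1 + k)%N by rewrite -{1}N_n; lia.
apply: (rep_char_inj (pchar_num _)) => g Gg.
rewrite eval_ZXY_rmorph rmorphN /= !rep_char_class.
rewrite mxtrace_permutation mxtrace_det.
have evE x y :
    eval_ZXY (fibonomial ((Zp_trunc n).+1 + k) k) (x + y) (- (x * y)) =
    qbin x y (Zp_trunc n).+1 k :> R[i] by exact: eval_fibonomial.
case: g {Gg} => i [].
  (* A reflection has trace 0 on z1 and -det = 1: take x = 1 and y = -1. *)
  rewrite mxtrace_z1_reflection expr1 opprK.
  have := evE 1 (-1); rewrite subrr mul1r opprK => ->.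
  apply: card_fixed_multisubsets_qbin.
  rewrite reflection_orbit_product; last by rewrite N_n.
  have -> : (Zp_trunc n).+1 = n./2.*2.
    by apply: succn_inj; rewrite N_n -[LHS](odd_double_half n) odd_n.
  by rewrite (half_bit_double _ true) reflection_root_product.
(* A rotation has trace z + 1/z on z1 and -det = -1: take x = z and y = 1/z. *)
set z := cis (2 * pi / (Zp_trunc n).+2%:R * i%:R : R).
have prim_z := rotation_prim_root R i.
rewrite mxtrace_z1_rotation -/z expr0.
have := evE z z^-1; rewrite divff => [->|]; last exact: cis_neq0.
apply: card_fixed_multisubsets_qbin; rewrite rotation_orbit_product.
rewrite (rotation_root_product prim_z) ?order_rotation_dvd //.
by rewrite (dvdn_odd (order_rotation_dvd i)) ?N_n.
Qed.
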